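(* Let $n>1$ and $k\ge 1$ be integers, and let $i,j\in\{0,1,\dots,n-1\}$ be vertices of the unitary Cayley graph $X_n$. Then the number of $i$-$j$ walks of length $k$ in $X_n$ is $$w(X_n,k,i,j)=\left(\frac{n}{\mathrm{rad}(n)}\right)^{k-1} w\bigl(X_{\mathrm{rad}(n)},\,k,\; i \bmod \mathrm{rad}(n),\; j \bmod \mathrm{rad}(n)\bigr),$$ where $i \bmod \mathrm{rad}(n)$ denotes the residue of $i$ modulo $\mathrm{rad}(n)$, regarded as a vertex of $X_{\mathrm{rad}(n)}$.
   Context: For an integer $n>1$, the unitary Cayley graph $X_n=\mathrm{Cay}(\mathbb{Z}_n,\mathbb{U}_n)$ is the undirected simple graph with vertex set $\mathbb{Z}_n=\{0,1,\dots,n-1\}$ in which $a$ and $b$ are adjacent if and only if $\gcd(a-b,n)=1$ (equivalently, $a-b$ is a unit of the ring $\mathbb{Z}_n$). $\mathrm{rad}(n)=\prod_{p\mid n}p$ is the product of the distinct primes dividing $n$. For a graph $X$ and vertices $u,v$ (not necessarily distinct), a $u$-$v$ walk of length $k$ is an alternating sequence $u=u_0,e_1,u_1,\dots,e_k,u_k=v$ of vertices and edges with $e_i=u_{i-1}u_i$ an edge of $X$ for each $i$ (repetitions allowed); $w(X,k,u,v)$ denotes the number of $u$-$v$ walks of length $k$ in $X$. *)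

(* Defs.v *)
From mathcomp Require Import all_boot all_order all_algebra.

Set Implicit Arguments.
Unset Strict Implicit.
Unset Printing Implicit Defensive.

Import GRing.Theory Num.Theory.

Record sgraph := SGraph {
  vertex :> finType;
  adj : rel vertex;
  adj_sym : symmetric adj;
  adj_irrefl : irreflexive adj
}.

Definition edges (X : sgraph) : {set {set X}} :=
  [set [set x; y] | x in X, y in X & adj x y].

(* A walk u_0, e_1, u_1, ..., e_k, u_k is stored as the pair (u, e) of its
   vertices and its edges; e is indexed from 0, so that e i is the paper's
   e_(i+1), whose ends are u_i (widen_ord) and u_(i+1) (lift ord0). *)
Definition is_walk (X : sgraph) (k : nat) (x y : X)
    (w : {ffun 'I_k.+1 -> X} * {ffun 'I_k -> {set X}}) : bool :=
  [&& w.1 ord0 == x, w.1 ord_max == y &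
      [forall i : 'I_k, (w.2 i \in edges X) &&
        (w.2 i == [set w.1 (widen_ord (leqnSn k) i); w.1 (lift ord0 i)])]].

Definition nwalks (X : sgraph) (k : nat) (x y : X) : nat :=
  #|[set w | @is_walk X k x y w]|.

Arguments nwalks : clear implicits.

(* The difference is taken in int: it must not be truncated. *)
Definition unitary_adj (n : nat) : rel 'I_n :=
  fun a b => gcdz (a%:Z - b%:Z)%R n%:Z == 1%Z.

Lemma unitary_adj_sym n : symmetric (@unitary_adj n).
Proof. by move=> a b; rewrite /unitary_adj -opprB gcdNz. Qed.

Lemma unitary_adj_irrefl n : 1 < n -> irreflexive (@unitary_adj n).
Proof.
by move=> n_gt1 a; rewrite /unitary_adj subrr gcd0z; case: n n_gt1 a => [|[]].
Qed.

Definition unitary_cayley (n : nat) (hn : 1 < n) : sgraph :=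
  SGraph (@unitary_adj_sym n) (unitary_adj_irrefl hn).

Definition radn (n : nat) : nat := \prod_(p <- primes n) p.

Lemma radn_gt0 n : 0 < radn n.
Proof.
by rewrite /radn big_seq prodn_cond_gt0 // => p; rewrite mem_primes => /andP[/prime_gt0].
Qed.

Lemma radn_gt1 n : 1 < n -> 1 < radn n.
Proof.
move=> n_gt1; have pn : pdiv n \in primes n.
  by rewrite mem_primes pdiv_prime // pdiv_dvd (ltnW n_gt1).
apply: (leq_trans (prime_gt1 (pdiv_prime n_gt1))).
apply: dvdn_leq (radn_gt0 n) _.
by rewrite /radn (big_rem _ pn) /= dvdn_mulr.
Qed.

(* Hence n %/ radn n is the exact quotient. *)
Lemma radn_dvdn n : 0 < n -> radn n %| n.
Proof.
move=> n_gt0; rewrite {2}(prod_prime_decomp n_gt0) prime_decompE big_map /radn.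
rewrite big_seq [X in _ %| X]big_seq; elim/big_ind2: _ => // [a b c d|p].
  exact: dvdn_mul.
by move=> pn; rewrite dvdn_exp // logn_gt0.
Qed.

Definition mod_radn (n : nat) (i : 'I_n) : 'I_(radn n) :=
  Ordinal (ltn_pmod i (radn_gt0 n)).

(* Main.v *)
Require Import Defs.
From mathcomp Require Import all_boot.
From mathcomp Require Import all_algebra.

Set Implicit Arguments.
Unset Strict Implicit.
Unset Printing Implicit Defensive.

(** Whether an integer is a unit modulo n depends only on its residue modulo
    rad(n), since n and rad(n) have the same prime divisors. Hence reduction
    modulo rad(n) is a map from X_n onto X_rad(n) that preserves and reflects
    adjacency, and each of its fibres has n / rad(n) elements: X_n is a
    balanced blow-up of X_rad(n), every vertex being replaced by an independent
    set of size n / rad(n).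

    In a blow-up with fibres of size m, a walk of the base lifts to a walk with
    prescribed ends by choosing freely, in its fibre, each of the k - 1 interior
    vertices; hence the factor m ^ (k - 1). This is [nwalks_blowup], proved by
    induction on the length, from the recurrence [nwalksS] that splits a walk
    after its first step. The arithmetic enters through [unitary_adj_mod_radn]
    (adjacency) and [card_fibre_mod_radn] (the size of the fibres). *)

(** As adjacency is irreflexive, an edge has two distinct elements, so that the
    unordered pair determines its ends up to exchange. *)
Lemma edges_pair (X : sgraph) (a b : X) :
  ([set a; b] \in edges X) = adj a b.
Proof.
apply/imset2P/idP => [[x y _ /[!inE]/andP[_ xy] ab]|ab]; last first.
  by exists a b; rewrite ?inE.
have /set2P a_xy : a \in [set x; y] by rewrite -ab set21.
have /set2P b_xy : b \in [set x; y] by rewrite -ab set22.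
have x_ab : x \in [set a; b] by rewrite ab set21.
have y_ab : y \in [set a; b] by rewrite ab set22.
case: a_xy b_xy x_ab y_ab => -> [] -> //.
- by move=> _ /set2P[]yx; rewrite yx adj_irrefl in xy.
- by rewrite adj_sym.
- by move=> /set2P[]yx; rewrite yx adj_irrefl in xy.
Qed.

Definition alternating (X : sgraph) (k : nat) : finType :=
  ({ffun 'I_k.+1 -> X} * {ffun 'I_k -> {set X}})%type.

Definition walk_behead (X : sgraph) k (w : alternating X k.+1) : alternating X k :=
  ([ffun i => w.1 (lift ord0 i)], [ffun i => w.2 (lift ord0 i)]).

(** In a simple graph the prepended edge is forced by its two ends; hence only
    the new vertex x has to be supplied. *)
Definition walk_cons (X : sgraph) k (x : X) (w : alternating X k) :
    alternating X k.+1 :=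
  ([ffun i => if unlift ord0 i is Some j then w.1 j else x],
   [ffun i => if unlift ord0 i is Some j then w.2 j else [set x; w.1 ord0]]).

Lemma walk_consK (X : sgraph) k (x : X) :
  cancel (@walk_cons X k x) (@walk_behead X k).
Proof.
by case=> u e; congr (_, _); apply/ffunP => i; rewrite !ffunE liftK.
Qed.

Lemma is_walk_cons (X : sgraph) k (x y : X) (w : alternating X k) :
  is_walk x y (walk_cons x w) = adj x (w.1 ord0) && is_walk (w.1 ord0) y w.
Proof.
have vertexS (i : 'I_k.+1) : (walk_cons x w).1 (lift ord0 i) = w.1 i.
  by rewrite ffunE liftK.
have vertex0 : (walk_cons x w).1 ord0 = x by rewrite ffunE unlift_none.
have edgeS (i : 'I_k) : (walk_cons x w).2 (lift ord0 i) = w.2 i.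
  by rewrite ffunE liftK.
have edge0 : (walk_cons x w).2 ord0 = [set x; w.1 ord0].
  by rewrite ffunE unlift_none.
have widen0 : widen_ord (leqnSn k.+1) ord0 = ord0 by apply: val_inj.
have widenS (i : 'I_k) :
    widen_ord (leqnSn k.+1) (lift ord0 i) = lift ord0 (widen_ord (leqnSn k) i).
  exact: val_inj.
have maxS : ord_max = lift ord0 (ord_max : 'I_k.+1) by apply: val_inj.
rewrite /is_walk vertex0 [in X in X == y]maxS vertexS !eqxx /= andbCA.
congr (_ && _); apply/forallP/andP => [wP|[xw /forallP wP] i].
  split.
    by have /andP[] := wP ord0; rewrite edge0 edges_pair.
  by apply/forallP => i; have := wP (lift ord0 i); rewrite edgeS widenS !vertexS.
have [j ->|->] := unliftP ord0 i; first by rewrite edgeS widenS !vertexS.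
by rewrite edge0 widen0 vertex0 vertexS edges_pair xw eqxx.
Qed.

Lemma walk_beheadK (X : sgraph) k (x y : X) (w : alternating X k.+1) :
  is_walk x y w -> walk_cons x (walk_behead w) = w.
Proof.
case: w => u e /and3P[/= /eqP u0 _ /forallP/(_ ord0)/andP[_ /eqP/= e0]].
congr (_, _); apply/ffunP => i; rewrite ffunE.
  by case: unliftP => [j ->|->]; rewrite ?ffunE.
case: unliftP => [j ->|->]; rewrite !ffunE // e0 -u0.
by congr [set u _; _]; apply: val_inj.
Qed.

Lemma nwalks0 (X : sgraph) (x y : X) : nwalks X 0 x y = (x == y).
Proof.
have [<-|xy] := eqVneq x y; last first.
  apply: eq_card0 => -[u e]; rewrite inE; apply/and3P => -[/= /eqP ux /eqP uy _].
  by case/eqP: xy; rewrite -ux -uy; congr (u _); apply: val_inj.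
apply: etrans (cards1 (([ffun=> x], [ffun=> set0]) : alternating X 0)).
apply: eq_card => -[u e]; rewrite !inE; apply/and3P/eqP => [[/= /eqP ux _ _]|[-> ->]].
  congr (_, _); apply/ffunP => i; last by case: i.
  by rewrite ord1 ffunE.
by rewrite !ffunE eqxx; split=> //; apply/forallP => -[].
Qed.

(** Deleting the first vertex and the first edge is a bijection from the walks
    of length k + 1 starting at x onto the walks of length k that start at a
    neighbour of x; these are then sorted by their starting point. *)
Lemma nwalksS (X : sgraph) k (x y : X) :
  nwalks X k.+1 x y = \sum_(z | adj x z) nwalks X k z y.
Proof.
transitivity (\sum_(w : alternating X k | adj x (w.1 ord0) &&
                                          is_walk (w.1 ord0) y w) 1).
  rewrite (reindex_onto (@walk_behead X k) (walk_cons x)); last first.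
    by move=> w _; apply: walk_consK.
  rewrite /nwalks -sum1_card; apply: eq_bigl => w.
  rewrite inE -is_walk_cons; apply/idP/andP => [wP|[wP /eqP <-]//].
  by rewrite (walk_beheadK wP) eqxx.
rewrite (partition_big (fun w : alternating X k => w.1 ord0) (adj x)) /=; last first.
  by move=> w /andP[].
apply: eq_bigr => z xz; rewrite /nwalks -sum1_card; apply: eq_bigl => w.
rewrite inE; apply/andP/idP => [[/andP[_ wP] /eqP <-]//|wP].
by have /and3P[/eqP wz _ _] := wP; rewrite wz xz wP eqxx.
Qed.

Lemma nwalks1 (X : sgraph) (x y : X) : nwalks X 1 x y = adj x y.
Proof.
rewrite nwalksS (eq_bigr (fun z => if z == y then 1 else 0)) => [|z _]; last first.
  by rewrite nwalks0; case: eqP.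
rewrite -big_mkcondr /=; case xy: (adj x y).
  by rewrite (big_pred1 y) // => z /=; case: eqP => [->|]; rewrite ?xy ?andbF.
by rewrite big_pred0 // => z /=; case: eqP => [->|]; rewrite ?xy ?andbF.
Qed.

(** At length 1 both ends are prescribed, so nothing is free to choose; each
    further step has one more interior vertex, to be chosen among the m
    elements of its fibre. The count of the remaining walks depends only on the
    image of that vertex, so summing over a fibre amounts to multiplying by m. *)
Lemma nwalks_blowup (X Y : sgraph) (p : X -> Y) (m k : nat) (x y : X) :
    (forall a b, adj a b = adj (p a) (p b)) ->
    (forall c, #|[set a | p a == c]| = m) ->
  nwalks X k.+1 x y = m ^ k * nwalks Y k.+1 (p x) (p y).
Proof.
move=> adj_p card_p; elim: k x => [|k IHk] x.
  by rewrite expn0 mul1n !nwalks1 adj_p.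
rewrite nwalksS [in RHS]nwalksS (partition_big p (adj (p x))) /=; last first.
  by move=> z; rewrite adj_p.
rewrite expnS -mulnA !big_distrr /=; apply: eq_bigr => c xc.
rewrite (eq_bigr (fun=> m ^ k * nwalks Y k.+1 c (p y))); last first.
  by move=> z /andP[_ /eqP <-].
rewrite sum_nat_const -(card_p c) cardsE; congr (_ * _).
apply: eq_card => z; rewrite -!topredE /= adj_p -[RHS]/(p z == c).
by case: eqP => [->|_]; rewrite ?xc ?andbF.
Qed.

(** Coprimality with a product is coprimality with each factor, and coprimality
    with a power p ^ e, e > 0, is coprimality with p; the two products have the
    same bases. *)
Lemma coprime_radn (m n : nat) : 0 < n -> coprime m (radn n) = coprime m n.
Proof.
move=> n_gt0; rewrite [in RHS](prod_prime_decomp n_gt0) prime_decompE big_map.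
rewrite /radn big_seq [in RHS]big_seq.
elim/big_ind2: _ => // [a b c d ab cd|p pn]; first by rewrite !coprimeMr ab cd.
by rewrite coprime_pexpr // logn_gt0.
Qed.

Lemma unitary_adj_mod_radn (n : nat) (a b : 'I_n) :
  unitary_adj a b = unitary_adj (mod_radn a) (mod_radn b).
Proof.
have n_gt0 : 0 < n by apply: leq_trans (ltn_ord a).
rewrite /unitary_adj.
transitivity (gcdz (a%:Z - b%:Z)%R (radn n)%:Z == 1%Z).
  by rewrite /gcdz !eqz_nat; apply/esym/coprime_radn.
rewrite -[in LHS]gcdz_modl -[in RHS]gcdz_modl /= -!modz_nat.
by rewrite modzDml -[in RHS]modzDmr modzNm modzDmr.
Qed.

(** The fibre of c consists of the numbers q * rad(n) + c for q < n / rad(n),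
    by Euclidean division. *)
Lemma card_fibre_mod_radn (n : nat) (c : 'I_(radn n)) :
  0 < n -> #|[set a : 'I_n | mod_radn a == c]| = n %/ radn n.
Proof.
move=> n_gt0; have nE := divnK (radn_dvdn n_gt0).
have lift_lt (q : 'I_(n %/ radn n)) : q * radn n + c < n.
  rewrite -[X in _ < X]nE (leq_trans (_ : _ < q.+1 * radn n)) ?leq_mul //.
  by rewrite mulSn addnC ltn_add2r.
rewrite -[RHS]card_ord -(card_imset _ (_ : injective (fun q => Ordinal (lift_lt q)))).
  apply: eq_card => a; rewrite inE; apply/eqP/imsetP => [ac|[q _ ->]].
    have aq : a %/ radn n < n %/ radn n by rewrite ltn_divLR ?radn_gt0 ?nE.
    by exists (Ordinal aq) => //; apply: val_inj; rewrite /= -ac /= -divn_eq.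
  by apply: val_inj; rewrite /= modnMDl modn_small.
move=> q q' [/addIn/eqP]; rewrite eqn_pmul2r ?radn_gt0 // => /eqP.
exact: val_inj.
Qed.

Theorem theorem4p4 (n k : nat) (hn : 1 < n) (hk : 1 <= k) (i j : 'I_n) :
  nwalks (unitary_cayley hn) k i j =
    (n %/ radn n) ^ (k - 1) *
    nwalks (unitary_cayley (radn_gt1 hn)) k (mod_radn i) (mod_radn j).
Proof.
case: k hk => // k _; rewrite subn1.
apply: (@nwalks_blowup (unitary_cayley hn) (unitary_cayley (radn_gt1 hn))
         (@mod_radn n)) => [a b|c]; first exact: unitary_adj_mod_radn.
by apply: card_fibre_mod_radn; apply: ltnW.
Qed.
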